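(* Let $N\geq 1$ and $K\geq 0$ be natural numbers. (1) The Boltzmann-on-multisets distribution is stable under reversal: as functions $\{0,1,\ldots,(N-1)\cdot K\}\to\mathcal{D}\big(\mathcal{M}[K](\boldsymbol{N})\big)$, $$\mathcal{D}\big(\mathcal{M}(\mathrm{rev}_{N-1})\big)\circ\mathrm{BoM}[N,K] \;=\; \mathrm{BoM}[N,K]\circ\mathrm{rev}_{(N-1)\cdot K}.$$ (2) For a number $0\leq i\leq (N-1)\cdot K$, let $S := \{v\in\boldsymbol{N}^{K}\mid\mathrm{sum}(v)=i\}$, where $\mathrm{sum}(v)$ is the sum of the entries of $v$, and let $\mathrm{uni} := \sum_{v\in S}\frac{1}{C_{N}(K,i)}|v\rangle$ be the uniform distribution on $S$. Then $$\mathcal{D}(\mathrm{acc})(\mathrm{uni}) \;=\; \mathrm{BoM}[N,K](i).$$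
   Context: For $N\geq 1$ write $\boldsymbol{N}=\{0,1,\ldots,N-1\}\subseteq\mathbb{N}$. For $K\in\mathbb{N}$ and $0\leq i\leq (N-1)\cdot K$, the $N$-nomial coefficient is $$C_{N}(K,i) := \big|\{(n_1,\ldots,n_K)\in\boldsymbol{N}^{K} \mid n_1+\cdots+n_K = i\}\big|.$$ For $L\in\mathbb{N}$, $\mathrm{rev}_{L}\colon\{0,\ldots,L\}\to\{0,\ldots,L\}$ is the bijection $\mathrm{rev}_{L}(i)=L-i$. A multiset over a set $X$ is a function $\varphi\colon X\to\mathbb{N}$ with finite support, also written as a formal sum $\sum_x\varphi(x)|x\rangle$ (multiplicities of equal elements are added). Its size is $\|\varphi\| := \sum_{x}\varphi(x)$, and $\mathcal{M}[K](X)$ is the set of multisets over $X$ of size $K$. For $f\colon X\to Y$, the function $\mathcal{M}(f)\colon\mathcal{M}[K](X)\to\mathcal{M}[K](Y)$ is $\mathcal{M}(f)\big(\sum_k n_k|x_k\rangle\big) := \sum_k n_k|f(x_k)\rangle$. The multiset coefficient of $\varphi$ is $(\varphi) := \|\varphi\|!/\prod_{x}\varphi(x)!$. The accumulation function $\mathrm{acc}\colon X^{K}\to\mathcal{M}[K](X)$ is $\mathrm{acc}(x_1,\ldots,x_K) := 1|x_1\rangle+\cdots+1|x_K\rangle$. For $0\leq i\leq (N-1)\cdot K$, $\mathcal{M}[K,i](\boldsymbol{N})$ is the set of $\varphi\in\mathcal{M}[K](\boldsymbol{N})$ with $\sum_{0\leq j<N}\varphi(j)\cdot j=i$. $\mathcal{D}(X)$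 is the set of finitely supported probability distributions on $X$; a formal sum $\sum_k r_k|x_k\rangle$ with $r_k\in[0,1]$, $\sum_k r_k=1$ denotes the distribution giving weight $r_k$ to $x_k$ (weights of equal elements are added). For $f\colon X\to Y$ the image distribution is $\mathcal{D}(f)\big(\sum_k r_k|x_k\rangle\big) := \sum_k r_k|f(x_k)\rangle\in\mathcal{D}(Y)$. The Boltzmann-on-multisets distributions are given by the function $\mathrm{BoM}[N,K]\colon\{0,\ldots,(N-1)\cdot K\}\to\mathcal{D}\big(\mathcal{M}[K](\boldsymbol{N})\big)$ defined by $$\mathrm{BoM}[N,K](i) := \sum_{\varphi\in\mathcal{M}[K,i](\boldsymbol{N})}\frac{(\varphi)}{C_{N}(K,i)}\,|\varphi\rangle .$$ *)

(* Defs.v *)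
From HB Require Import structures.
From mathcomp Require Import all_boot all_order all_algebra.
From mathcomp Require Import finmap multiset reals.

Set Implicit Arguments.
Unset Strict Implicit.
Unset Printing Implicit Defensive.

Import Order.TTheory GRing.Theory Num.Theory.

Local Open Scope fset_scope.
Local Open Scope mset_scope.
Local Open Scope nat_scope.

Identity Coercion fsfun_of_multiset : multiset >-> fsfun.

Definition msize (X : choiceType) (phi : {mset X}) : nat :=
  \sum_(x <- finsupp phi) phi x.

(* M[K](X) *)
Record msetK (K : nat) (X : choiceType) := MsetK {
  msetK_val :> {mset X};
  _ : msize msetK_val == K }.

HB.instance Definition _ K X := [isSub for @msetK_val K X].
HB.instance Definition _ K X := [Choice of msetK K X by <:].

Lemma msize_size (X : choiceType) (phi : {mset X}) : msize phi = size phi.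
Proof.
rewrite -sum1_size sum_mset /msize; apply: eq_bigr => x _.
by rewrite muln1.
Qed.

Lemma msizeP (K : nat) (X : choiceType) (phi : msetK K X) : msize phi = K.
Proof. exact/eqP/(valP phi). Qed.

Lemma big_msetDE (X I : choiceType) (s : seq I) (F : I -> {mset X}) (x : X) :
  (\big[msetD/mset0]_(k <- s) F k) x = \sum_(k <- s) F k x.
Proof.
by elim: s => [|k s IH]; rewrite ?(big_nil, big_cons) ?mset0E ?msetE2 ?IH.
Qed.

Lemma size_big_msetD (X I : choiceType) (s : seq I) (F : I -> {mset X}) :
  size (\big[msetD/mset0]_(k <- s) F k) = \sum_(k <- s) size (F k).
Proof.
elim: s => [|k s IH]; rewrite ?(big_nil, big_cons) ?enum_mset0 //.
have P : perm_eq (msetD (F k) (\big[msetD/mset0]_(j <- s) F j))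
                 (F k ++ (\big[msetD/mset0]_(j <- s) F j)).
  by apply/allP => a _ /=; rewrite count_cat !count_mem_mset msetE2.
by rewrite (perm_size P) size_cat IH.
Qed.

Definition mset_image (X Y : choiceType) (f : X -> Y)
    (phi : {mset X}) : {mset Y} :=
  \big[msetD/mset0]_(x <- finsupp phi) msetn (phi x) (f x).

Lemma mset_map_subproof (K : nat) (X Y : choiceType) (f : X -> Y)
    (phi : msetK K X) :
  msize (mset_image f phi) == K.
Proof.
rewrite msize_size size_big_msetD -[X in _ == X](msizeP phi).
by apply/eqP/eq_bigr => x _; rewrite enum_msetn size_nseq.
Qed.

(* M(f) : M[K](X) -> M[K](Y) *)
Definition mset_map (K : nat) (X Y : choiceType) (f : X -> Y)
    (phi : msetK K X) : msetK K Y :=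
  MsetK (mset_map_subproof f phi).

Lemma acc_subproof (K : nat) (X : choiceType) (t : K.-tuple X) :
  msize (\big[msetD/mset0]_(x <- t) [mset x]) == K.
Proof.
rewrite msize_size size_big_msetD -[X in _ == X](size_tuple t) -sum1_size.
by apply/eqP/eq_bigr => x _; rewrite enum_msetn.
Qed.

Definition acc (K : nat) (X : choiceType) (t : K.-tuple X) : msetK K X :=
  MsetK (acc_subproof t).

Lemma accE (K : nat) (X : choiceType) (t : K.-tuple X) (x : X) :
  acc t x = count_mem x t.
Proof.
rewrite big_msetDE -sum1_count [RHS]big_mkcond; apply: eq_bigr => y _.
by rewrite msetnE eq_sym.
Qed.

Lemma acc_eq (K : nat) (X : choiceType) (t : K.-tuple X) (phi : msetK K X) :
  (acc t == phi) = perm_eq t phi.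
Proof.
apply/eqP/idP => [<-|/permP tphi].
  by apply/allP => a _ /=; rewrite count_mem_mset -accE.
apply/val_inj/msetP => a.
by rewrite [LHS]accE tphi; apply: count_mem_mset.
Qed.

Section FiniteMultisets.
Variables (K : nat) (X : finType).

Definition mset_tuple (phi : msetK K X) : K.-tuple X :=
  tcast (etrans (esym (msize_size phi)) (msizeP phi)) (in_tuple phi).

Lemma mset_tupleK : cancel mset_tuple (@acc K X).
Proof.
by move=> phi; apply/eqP; rewrite acc_eq /mset_tuple val_tcast /=.
Qed.

HB.instance Definition _ := CanIsCountable mset_tupleK.
HB.instance Definition _ :=
  isFinite.Build (msetK K X) (pcan_enumP (can_pcan mset_tupleK)).
End FiniteMultisets.

(* The division is exact: see [mult_coefM]. *)
Definition mult_coef (X : choiceType) (phi : {mset X}) : nat :=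
  (msize phi)`! %/ \prod_(x <- finsupp phi) (phi x)`!.

Lemma size_permutationsM (X : choiceType) n (s U : seq X) :
  size s = n -> uniq U -> {subset s <= U} ->
  size (permutations s) * \prod_(x <- U) (count_mem x s)`! = n`!.
Proof.
move=> + uU; elim: n s => [|n IH] s szs sU.
  by move/size0nil: szs => ->; rewrite big1.
rewrite (perm_size (permutationsE _)) ?szs // size_allpairs_dep.
rewrite sumn_map big_distrl /= factS.
have -> : n.+1 = \sum_(x <- undup s) count_mem x s.
  rewrite -szs -sum1_size -big_undup_iterop_count; apply: eq_bigr => x _.
  by rewrite Monoid.iteropE iter_addn mul1n addn0.
rewrite big_distrl /=; apply: eq_big_seq => x; rewrite mem_undup => xs.
have szr : size (rem x s) = n by rewrite size_rem // szs.
rewrite -(IH _ szr); last by move=> y /mem_rem/sU.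
rewrite mulnCA; congr (_ * _).
have cE y : count_mem y s = (x == y) + count_mem y (rem x s).
  by rewrite (permP (perm_to_rem xs)).
rewrite !(bigD1_seq x (sU _ xs) uU) /= cE eqxx add1n factS mulnA.
congr (_ * _); apply: eq_bigr => y; rewrite eq_sym cE.
by move/negPf ->.
Qed.

Lemma mult_coefM (X : choiceType) (phi : {mset X}) :
  mult_coef phi * \prod_(x <- finsupp phi) (phi x)`! = (msize phi)`!.
Proof.
rewrite divnK //.
have := @size_permutationsM _ _ phi (finsupp phi) erefl (fset_uniq _).
rewrite msize_size => <-; last by move=> x; rewrite -msuppE.
rewrite dvdn_mull //; under [X in _ %| X]eq_bigr do rewrite count_mem_mset.
exact: dvdnn.
Qed.

Lemma mult_coefE (X : choiceType) (phi : {mset X}) :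
  mult_coef phi = size (permutations phi).
Proof.
apply/eqP; have := mult_coefM phi.
rewrite msize_size => /eqP.
rewrite -(@size_permutationsM _ _ phi (finsupp phi) erefl (fset_uniq _)).
  under [X in _ == _ * X]eq_bigr do rewrite count_mem_mset.
  rewrite eqn_pmul2r //.
  by apply: prodn_gt0 => x; apply: fact_gt0.
by move=> x; rewrite -msuppE.
Qed.

Lemma card_acc (K : nat) (X : finType) (phi : msetK K X) :
  #|[set t : K.-tuple X | acc t == phi]| = mult_coef phi.
Proof.
rewrite mult_coefE cardE -(size_map val).
apply/perm_size/uniq_perm; rewrite ?permutations_uniq //.
  by rewrite map_inj_uniq ?enum_uniq //; apply: val_inj.
move=> s; rewrite mem_permutations; apply/mapP/idP => [[t]|sphi].
  by rewrite mem_enum inE acc_eq => ? ->.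
have szs : size s == K by rewrite (perm_size sphi) -msize_size msizeP.
by exists (Tuple szs); rewrite // mem_enum inE acc_eq.
Qed.

(* For N >= 1, {0, ..., N-1} is 'I_N and rev_{N-1} on it is [@rev_ord N]; hence
   rev_L on {0, ..., L} = 'I_L.+1 is [@rev_ord L.+1]. *)

(* {v in N^K | sum(v) = i}, with N = 'I_N *)
Definition sum_tuples (N K i : nat) : {set K.-tuple 'I_N} :=
  [set v : K.-tuple 'I_N | \sum_(n <- v) n == i].

Definition nnomial (N K i : nat) : nat := #|sum_tuples N K i|.

(* M[K, i](N) *)
Definition sum_msets (N K i : nat) : {set msetK K 'I_N} :=
  [set phi : msetK K 'I_N | \sum_(j < N) phi j * j == i].

Lemma nnomial_gt0 (N K i : nat) :
  0 < N -> i <= N.-1 * K -> 0 < nnomial N K i.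
Proof.
case: N => // n _ /=; elim: K i => [|K IH] i; rewrite ?muln0.
  rewrite leqn0 => /eqP->; apply/card_gt0P.
  by exists [tuple]; rewrite inE big_nil.
rewrite mulnS => le_i.
have /card_gt0P[v] : 0 < nnomial n.+1 K (i - minn i n).
  apply: IH; rewrite leq_subLR; case: (leqP i n) => // _; exact: leq_addr.
rewrite inE => /eqP sv; apply/card_gt0P.
exists [tuple of inord (minn i n) :: v].
rewrite inE big_cons sv inordK ?subnKC ?geq_minl //.
by rewrite ltnS geq_minr.
Qed.

Lemma sum_acc (N K : nat) (t : K.-tuple 'I_N) :
  \sum_(j < N) acc t j * j = \sum_(n <- t) n.
Proof.
transitivity (\sum_(j < N) \sum_(n <- t | n == j) (j : nat)).
  apply: eq_bigr => j _.
  by rewrite -[X in X * _]/(acc t j) accE -sum1_count big_distrl /=;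
    apply: eq_bigr => n _; rewrite mul1n.
rewrite (exchange_big_dep xpredT) //=; apply: eq_bigr => n _.
by rewrite (big_pred1 n) // => j; rewrite eq_sym.
Qed.

Lemma sum_mult_coef (N K i : nat) :
  \sum_(phi in sum_msets N K i) mult_coef phi = nnomial N K i.
Proof.
rewrite /nnomial -sum1_card (partition_big (@acc K 'I_N)
  (fun phi => phi \in sum_msets N K i)) /=; last first.
  by move=> t; rewrite !inE sum_acc.
apply: eq_bigr => phi; rewrite inE => phii.
rewrite -card_acc -sum1_card; apply: eq_bigl => t; rewrite !inE.
case: eqP => [tphi|]; rewrite ?andbF // andbT.
by rewrite -sum_acc tphi.
Qed.

Local Open Scope ring_scope.

(* D(X); r <= 1 follows from nonnegativity and total mass 1. *)
Definition is_distr (R : realType) (X : choiceType)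
    (w : {fsfun X -> R with 0}) : bool :=
  [forall x : finsupp w, 0 <= w (val x)] && (\sum_(x <- finsupp w) w x == 1).

Record distr (R : realType) (X : choiceType) := Distr {
  distr_val :> {fsfun X -> R with 0};
  _ : is_distr distr_val }.

HB.instance Definition _ R X := [isSub for @distr_val R X].
HB.instance Definition _ R X := [Choice of distr R X by <:].

(* The formal sum of the r_k|x_k>, k ranging over s. *)
Definition formal_sum (R : realType) (I X : choiceType) (s : seq I)
    (r : I -> R) (x : I -> X) : {fsfun X -> R with 0} :=
  [fsfun y in [fset x k | k in s] => \sum_(k <- s | x k == y) r k].

Lemma formal_sumE (R : realType) (I X : choiceType) (s : seq I)
    (r : I -> R) (x : I -> X) (y : X) :
  formal_sum s r x y = \sum_(k <- s | x k == y) r k.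
Proof.
rewrite fsfunE; case: ifPn => // yNs; rewrite big_seq_cond big_pred0 // => k.
apply/negP => /andP[ks /eqP xky]; case/negP: yNs.
by apply/imfsetP; exists k.
Qed.

Lemma formal_sum_distr (R : realType) (I X : choiceType) (s : seq I)
    (r : I -> R) (x : I -> X) :
  (forall k, k \in s -> 0 <= r k) -> \sum_(k <- s) r k = 1 ->
  is_distr (formal_sum s r x).
Proof.
move=> r0 r1; apply/andP; split.
  apply/forallP => y; rewrite formal_sumE big_seq_cond sumr_ge0 // => k.
  by case/andP => /r0.
rewrite -r1; set w := formal_sum s r x; apply/eqP.
have ws : (finsupp w `<=` [fset x k | k in s])%fset by apply: finsupp_sub.
rewrite (big_fset_incl _ ws) /=; last by move=> y _ /fsfun_dflt.
under eq_bigr do rewrite /w formal_sumE.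
rewrite (exchange_big_dep xpredT) //= !big_seq; apply: eq_bigr => k ks.
have xk : x k \in [fset x j | j in s]%fset by apply/imfsetP; exists k.
rewrite big_mkcond (big_fsetD1 _ xk) /= eqxx big1_fset ?addr0 // => y.
by rewrite !inE => /andP[/negPf ynx _] _; rewrite eq_sym ynx.
Qed.

Lemma distr_map_subproof (R : realType) (X Y : choiceType) (f : X -> Y)
    (w : distr R X) : is_distr (formal_sum (finsupp w) w f).
Proof.
have /andP[/forallP w0 /eqP w1] := valP w.
by apply: formal_sum_distr => // x xw; apply: (w0 [` xw]%fset).
Qed.

(* D(f) : D(X) -> D(Y) *)
Definition distr_map (R : realType) (X Y : choiceType) (f : X -> Y)
    (w : distr R X) : distr R Y :=
  Distr (distr_map_subproof f w).

Lemma uni_subproof (R : realType) (N K : nat) (hN : (0 < N)%N)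
    (i : 'I_(N.-1 * K).+1) :
  is_distr (formal_sum (enum (sum_tuples N K i))
    (fun=> (nnomial N K i)%:R^-1 : R) id).
Proof.
apply: formal_sum_distr => [v _|]; first by rewrite invr_ge0 ler0n.
rewrite big_enum sumr_const -/(nnomial N K i) -[LHS]mulr_natl divff //.
by rewrite pnatr_eq0 -lt0n nnomial_gt0 // -ltnS.
Qed.

Definition uni (R : realType) (N K : nat) (hN : (0 < N)%N)
    (i : 'I_(N.-1 * K).+1) : distr R (K.-tuple 'I_N) :=
  Distr (uni_subproof R hN i).

Lemma BoM_subproof (R : realType) (N K : nat) (hN : (0 < N)%N)
    (i : 'I_(N.-1 * K).+1) :
  is_distr (formal_sum (enum (sum_msets N K i))
    (fun phi => (mult_coef phi)%:R / (nnomial N K i)%:R : R) id).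
Proof.
apply: formal_sum_distr => [v _|]; first by rewrite divr_ge0 ?ler0n.
rewrite big_enum -mulr_suml -natr_sum sum_mult_coef divff //.
by rewrite pnatr_eq0 -lt0n nnomial_gt0 // -ltnS.
Qed.

Definition BoM (R : realType) (N K : nat) (hN : (0 < N)%N)
    (i : 'I_(N.-1 * K).+1) : distr R (msetK K 'I_N) :=
  Distr (BoM_subproof R hN i).

(* Main.v *)
(** The distribution [BoM i] is the image under [acc] of the uniform
    distribution on the vectors of sum [i], since [mult_coef phi] counts the
    vectors that accumulate to [phi].  Reversing every entry commutes with
    [acc] and is a bijection from the vectors of sum [i] onto those of sum
    [(N-1) * K - i], so part (1) follows from part (2) by functoriality. *)
Require Import Defs.
From mathcomp Require Import all_boot all_order all_algebra.
From mathcomp Require Import finmap multiset reals boolp.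

Set Implicit Arguments.
Unset Strict Implicit.
Unset Printing Implicit Defensive.

Import Order.TTheory GRing.Theory Num.Theory.

Local Open Scope mset_scope.
Local Open Scope nat_scope.

(** Enumerating [phi] with repetitions absorbs the multiplicities, so that [phi] can later be
    replaced by any permuted list. *)
Lemma mset_imageE (X Y : choiceType) (f : X -> Y) (phi : {mset X}) (y : Y) :
  mset_image f phi y = \sum_(x <- phi) (f x == y).
Proof.
rewrite big_msetDE sum_mset; apply: eq_bigr => x _.
by rewrite msetnE eq_sym; case: eqP; rewrite ?muln1 ?muln0.
Qed.

(** Naturality of [acc]: at [y], both sides count the entries of [t] that [f] sends to [y]. *)
Lemma mset_map_acc (K : nat) (X Y : choiceType) (f : X -> Y)
    (t : K.-tuple X) :
  mset_map f (acc t) = acc (map_tuple f t).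
Proof.
apply/val_inj/msetP => y.
have act : perm_eq (acc t) t by rewrite perm_sym -acc_eq.
rewrite [LHS]mset_imageE [LHS](perm_big _ act) [RHS]accE count_map.
by rewrite -sum1_count [RHS]big_mkcond; apply: eq_bigr => x _ /=; case: eqP.
Qed.

(** An entry and its reversal add up to [N.-1]. *)
Lemma sum_rev_ord (N : nat) (s : seq 'I_N) :
  \sum_(n <- s) rev_ord n = N.-1 * size s - \sum_(n <- s) n.
Proof.
apply/esym/eqP; rewrite -(eqn_add2r (\sum_(n <- s) n)) -big_split /=.
have revK (n : 'I_N) : N - n.+1 + n = N.-1.
  by rewrite -subn1 -addn1 addnC subnDA subnAC subnKC // subn1 -ltnS
    (ltn_predK (ltn_ord n)).
under [X in _ == X]eq_bigr do rewrite revK.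
rewrite big_const_seq count_predT iter_addn_0 subnK //.
(* The truncated subtraction loses nothing, since each entry is at most [N.-1]. *)
rewrite -[leqRHS]iter_addn_0 -(count_predT s) -big_const_seq.
by apply: leq_sum => n _; rewrite -(revK n) leq_addl.
Qed.

Lemma map_rev_ordK (N K : nat) :
  involutive (@map_tuple K _ _ (@rev_ord N)).
Proof. by move=> t; apply/val_inj; rewrite /= mapK //; apply: rev_ordK. Qed.

Lemma map_rev_sum_tuples (N K : nat) (i : 'I_(N.-1 * K).+1)
    (v : K.-tuple 'I_N) :
  (map_tuple (@rev_ord N) v \in sum_tuples N K i)
    = (v \in sum_tuples N K (rev_ord i)).
Proof.
(* One implication, for arbitrary [j], gives both directions because reversal is an involution; the
   second also needs [i <= N.-1 * K] to undo the double subtraction. *)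
have sum_rev (t : K.-tuple 'I_N) (j : nat) :
    t \in sum_tuples N K j ->
    map_tuple (@rev_ord N) t \in sum_tuples N K (N.-1 * K - j).
  by rewrite !inE big_map sum_rev_ord size_tuple => /eqP ->.
apply/idP/idP => /sum_rev; first by rewrite map_rev_ordK /= subSS.
by rewrite /= subSS subKn // -ltnS.
Qed.

Lemma nnomial_rev (N K : nat) (i : 'I_(N.-1 * K).+1) :
  nnomial N K (rev_ord i) = nnomial N K i.
Proof.
rewrite /nnomial -[RHS](card_preimset _ (inv_inj (@map_rev_ordK N K))).
by apply: eq_card => v; rewrite -map_rev_sum_tuples [RHS]in_set.
Qed.

Local Open Scope ring_scope.

Lemma formal_sum_enumE (R : realType) (X : finType) (A : {set X}) (r : X -> R)
    (x : X) :
  formal_sum (enum A) r id x = if x \in A then r x else 0.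
Proof.
rewrite formal_sumE big_enum_cond big_mkcond (bigD1 x) //= eqxx andbT.
by rewrite big1 ?addr0 // => y /negPf yx; rewrite yx andbF.
Qed.

(** On a finite type the sum need not be restricted to the support: the other points have weight
    0. *)
Lemma distr_mapE (R : realType) (X : finType) (Y : choiceType) (f : X -> Y)
    (w : distr R X) (y : Y) :
  distr_map f w y = \sum_(x | f x == y) w x.
Proof.
rewrite [LHS]formal_sumE [LHS]big_mkcond [RHS]big_mkcond /=.
rewrite big_uniq ?fset_uniq //= big_mkcond; apply: eq_bigr => x _.
by case: finsuppP => //; case: ifP.
Qed.

Lemma distr_map_comp (R : realType) (X Y : finType) (Z : choiceType)
    (f : X -> Y) (g : Y -> Z) (w : distr R X) :
  distr_map g (distr_map f w) = distr_map (g \o f) w.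
Proof.
apply/val_inj/fsfunP => z; rewrite [LHS]distr_mapE [RHS]distr_mapE.
under eq_bigr do rewrite distr_mapE.
rewrite (exchange_big_dep (fun x => g (f x) == z)) /=; last first.
  by move=> y x /eqP <- /eqP ->.
(* After the exchange, each [x] contributes only through [y = f x]. *)
apply: eq_bigr => x gfx; rewrite (big_pred1 (f x)) // => y /=.
by rewrite [f x == y]eq_sym; case: (y =P f x) => [->|]; rewrite ?andbF ?gfx.
Qed.

Lemma uniE (R : realType) (N K : nat) (hN : (0 < N)%N)
    (i : 'I_(N.-1 * K).+1) (v : K.-tuple 'I_N) :
  uni R hN i v = if v \in sum_tuples N K i then (nnomial N K i)%:R^-1 else 0.
Proof. exact: formal_sum_enumE. Qed.

Lemma BoME (R : realType) (N K : nat) (hN : (0 < N)%N)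
    (i : 'I_(N.-1 * K).+1) (phi : msetK K 'I_N) :
  BoM R hN i phi =
    if phi \in sum_msets N K i
    then (mult_coef phi)%:R / (nnomial N K i)%:R else 0.
Proof. exact: formal_sum_enumE. Qed.

Lemma distr_map_rev_uni (R : realType) (N K : nat) (hN : (0 < N)%N)
    (i : 'I_(N.-1 * K).+1) :
  distr_map (map_tuple (@rev_ord N)) (uni R hN i) = uni R hN (rev_ord i).
Proof.
apply/val_inj/fsfunP => v; rewrite [LHS]distr_mapE [RHS]uniE nnomial_rev.
(* By involutivity, the only tuple reversed to [v] is the reversal of [v]. *)
rewrite (big_pred1 (map_tuple (@rev_ord N) v)); last first.
  by move=> t /=; rewrite (can2_eq (@map_rev_ordK N K) (@map_rev_ordK N K)).
by rewrite uniE map_rev_sum_tuples.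
Qed.

Lemma distr_map_acc_uni (R : realType) (N K : nat) (hN : (0 < N)%N)
    (i : 'I_(N.-1 * K).+1) :
  distr_map (@acc K 'I_N) (uni R hN i) = BoM R hN i.
Proof.
apply/val_inj/fsfunP => phi; rewrite [LHS]distr_mapE [RHS]BoME.
(* The sum of a tuple depends only on its accumulation, so the weight is constant on the fibre over
   [phi], whose size is [mult_coef phi]. *)
transitivity (\sum_(t : K.-tuple 'I_N | acc t == phi)
    if phi \in sum_msets N K i then (nnomial N K i)%:R^-1 : R else 0).
  by apply: eq_bigr => t /eqP <-; rewrite uniE !inE sum_acc.
rewrite sumr_const -card_acc cardsE; case: ifP => _; last by rewrite mul0rn.
by rewrite mulr_natl.
Qed.

Theorem lemma5 (R : realType) (N K : nat) (hN : (1 <= N)%N) :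
  (distr_map (mset_map (@rev_ord N)) \o BoM R hN
     = BoM R hN \o @rev_ord (N.-1 * K).+1
     :> ('I_(N.-1 * K).+1 -> distr R (msetK K 'I_N)))
  /\ (forall i : 'I_(N.-1 * K).+1,
        distr_map (@acc K 'I_N) (uni R hN i) = BoM R hN i).
Proof.
split; last exact: distr_map_acc_uni.
apply/funext => i /=.
rewrite -!distr_map_acc_uni -distr_map_rev_uni !distr_map_comp.
(* Both sides are now images of [uni R hN i]; only the two maps on tuples remain to be compared. *)
by congr distr_map; apply/funext => t /=; apply: mset_map_acc.
Qed.
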